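(* Let $p<q$ be primes. Then every divisor $f\in\mathbb{Z}[x]$ of $x^{pq}-1$ is coefficient convex.
   Context: Divisors are taken in $\mathbb{Z}[x]$, i.e. $x^{pq}-1=f\cdot h$ with $h\in\mathbb{Z}[x]$. For a nonzero polynomial $f(x)=\sum_{j} c_jx^j\in\mathbb{Z}[x]$ put $\mathcal{C}(f)=\{c_j : 0\le j\le \deg f\}$ and $\mathcal{C}_0(f)=\mathcal{C}(f)\cup\{0\}$. The polynomial $f$ is called coefficient convex if there are integers $a\le b$ such that $\mathcal{C}_0(f)$ is exactly the set of consecutive integers $\{a,a+1,\ldots,b\}$. *)

(* Defs.v *)
From HB Require Import structures.
From mathcomp Require Import all_boot all_order all_algebra.

Set Implicit Arguments.
Unset Strict Implicit.
Unset Printing Implicit Defensive.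

Import Order.TTheory GRing.Theory Num.Theory.
Local Open Scope ring_scope.

(* The library's [%|] on polynomials is divisibility up to a nonzero scalar
   factor, so divisibility in Z[x] is spelled out. *)
Definition divides_in_Zx (f g : {poly int}) : Prop :=
  exists h : {poly int}, g = f * h.

(* [polyseq f] lists c_0, ..., c_(deg f) when f != 0; it is empty when f = 0. *)
Definition coef_set (f : {poly int}) : pred int :=
  [pred c | c \in polyseq f].

Definition coef_set0 (f : {poly int}) : pred int :=
  [pred c | (c \in coef_set f) || (c == 0)].

Definition coefficient_convex (f : {poly int}) : Prop :=
  exists a b : int, a <= b /\
    forall c : int, (c \in coef_set0 f) = (a <= c <= b).

(* Main.v *)
(* The divisors are, up to sign, the sixteen products of Phi_1, Phi_p, Phi_q and
   Phi_pq.  Any set of coefficients in {-1, 0, 1} becomes an interval once 0 is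
   added, so only two products are not immediate: Phi_1 Phi_pq, whose
   coefficients lie in [-2, 2] and include 1 and -1, and Phi_p Phi_q, whose
   coefficients are 1, ..., p.  The flatness of Phi_pq comes from
   (1 - X^pq) Phi_pq = (1 - X) sum_(i < q, j < p) X^(p i + q j),
   where the exponents p i + q j are pairwise distinct. *)

Require Import Defs.
From HB Require Import structures.
From mathcomp Require Import all_boot all_order all_algebra.
From mathcomp Require Import algC cyclotomic zify ring.

Set Implicit Arguments.
Unset Strict Implicit.
Unset Printing Implicit Defensive.

Import Order.TTheory GRing.Theory Num.Theory.
Local Open Scope ring_scope.

(** * Coefficient sets and criteria for convexity *)

(** Coefficients past the degree read as the default 0, so letting [n] range over all naturals adds
    exactly the 0 that [coef_set0] adjoins. *)
Lemma coef_set0P (f : {poly int}) (c : int) :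
  reflect (exists n, f`_n = c) (c \in coef_set0 f).
Proof.
rewrite !inE; apply: (iffP orP) => [[/(nthP 0)[n _ <-]|/eqP->]|[n <-]].
- by exists n.
- by exists (size f); rewrite nth_default.
- have [le_n|lt_n] := leqP (size f) n; first by right; rewrite nth_default.
  by left; rewrite mem_nth.
Qed.

Lemma coefficient_convexN (f : {poly int}) :
  coefficient_convex f -> coefficient_convex (- f).
Proof.
move=> [a [b [le_ab def_f]]]; exists (- b), (- a); split; first by rewrite lerN2.
move=> c; rewrite lerNl lerNr andbC -def_f.
apply/coef_set0P/coef_set0P => -[n def_c]; exists n; move: def_c; rewrite coefN.
  by move <-; rewrite opprK.
by move->; rewrite opprK.
Qed.

(** Only the membership of [m + 1] and of [-(m + 1)] is left open, and each settles one endpoint of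
    the interval independently. The case [m = 0] gives flat polynomials, [m = 1] serves
    [Phi_1 Phi_pq]. *)
Lemma coefficient_convex_near (m : nat) (f : {poly int}) :
    (forall n, `|f`_n| <= m.+1%:Z) ->
    (forall c : int, `|c| <= m%:Z -> c \in coef_set0 f) ->
  coefficient_convex f.
Proof.
move=> le_f sub_f.
exists (if - m.+1%:Z \in coef_set0 f then - m.+1%:Z else - m%:Z).
exists (if m.+1%:Z \in coef_set0 f then m.+1%:Z else m%:Z).
split=> [|c]; first by do 2!case: ifP => _; lia.
apply/idP/idP => [f_c|].
  have /coef_set0P[n def_c] := f_c; have := le_f n; rewrite def_c => le_c.
  have [c_lo|c_lo] := eqVneq c (- m.+1%:Z).
    by rewrite -c_lo f_c; case: ifP => _; lia.
  have [c_hi|c_hi] := eqVneq c m.+1%:Z.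
    by rewrite -c_hi f_c; case: ifP => _; lia.
  by do 2!case: ifP => _; lia.
have [le_c _|lt_c] := boolP (`|c| <= m%:Z); first exact: sub_f.
case: ifP => f_lo; case: ifP => f_hi le_c.
- have [-> //|->//] : c = - m.+1%:Z \/ c = m.+1%:Z by lia.
- by have -> : c = - m.+1%:Z by lia.
- by have -> : c = m.+1%:Z by lia.
- by lia.
Qed.

Lemma coefficient_convex_flat (f : {poly int}) :
  (forall n, `|f`_n| <= 1) -> coefficient_convex f.
Proof.
move=> le_f; apply: (coefficient_convex_near (m := 0)) => // c le_c.
by apply/coef_set0P; exists (size f); rewrite nth_default //; lia.
Qed.

(** * Divisors of products of cyclotomic polynomials *)

Lemma unit_poly_int (f h : {poly int}) : f * h = 1 -> f = 1 \/ f = -1.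
Proof.
move=> fh1; have: f \is a GRing.unit by apply/unitrPr; exists h.
rewrite poly_unitE => /andP[/size_poly1P[c _ ->]]; rewrite coefC /= qualifE /=.
by move/pred2P => [] ->; [left|right]; rewrite ?polyCN.
Qed.

(** ['Phi_d] is the minimal polynomial of [z] over the rationals, so it divides [f] there; being
    monic, it has its quotient in integer polynomials. *)
Lemma Cyclotomic_dvd (d : nat) (z : algC) (f : {poly int}) :
    d.-primitive_root z -> root (map_poly intr f) z ->
  exists g, f = 'Phi_d * g.
Proof.
move=> prim_z fz0; have [m [Dm _] min_m] := minCpolyP z.
have Dphi : m = map_poly intr 'Phi_d.
  apply: (map_poly_inj (ratr : {rmorphism rat -> algC})).
  rewrite -Dm (minCpoly_cyclotomic prim_z) -(Cintr_Cyclotomic prim_z).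
  by rewrite -map_poly_comp; apply: eq_map_poly => c /=; rewrite ratr_int.
have: (map_poly intr 'Phi_d %| map_poly (intr : int -> rat) f).
  rewrite -Dphi -min_m -map_poly_comp.
  by rewrite (eq_map_poly (g := intr)) // => c /=; rewrite ratr_int.
rewrite dvdp_rat_int => /(Pdiv.IdomainMonic.dvdpP (Cyclotomic_monic d))[g ->].
by exists g; rewrite mulrC.
Qed.

(** A primitive [d]-th root is a root of [f] or of [h], so ['Phi_d] can be cancelled from that
    factor. The mask records which cyclotomic factors went to [f]; a unit remains at the end. *)
Lemma divisor_prod_Cyclotomic (s : seq nat) (f h : {poly int}) :
    all (fun d => 0 < d)%N s -> \prod_(d <- s) 'Phi_d = f * h ->
  exists m : bitseq, let g := \prod_(d <- mask m s) 'Phi_d in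
    size m = size s /\ (f = g \/ f = - g).
Proof.
elim: s f h => [|d s IHs] f h /=.
  rewrite big_nil => _ /esym/unit_poly_int f1.
  by exists [::]; split; rewrite ?big_nil.
move=> /andP[d_gt0 s_gt0]; rewrite big_cons => Dfh.
have [z prim_z] := C_prim_root_exists d_gt0.
have phi_neq0 := monic_neq0 (Cyclotomic_monic d).
have: root (map_poly intr (f * h)) z.
  rewrite -Dfh rmorphM rootM /= (Cintr_Cyclotomic prim_z).
  by rewrite (root_cyclotomic prim_z) prim_z.
rewrite rmorphM rootM => /orP[] /(Cyclotomic_dvd prim_z)[g Dg].
  move: Dfh; rewrite Dg -mulrA => /(mulfI phi_neq0)/(IHs _ _ s_gt0)[m [sz_m Dm]].
  exists (true :: m); split; rewrite /= ?sz_m // big_cons.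
  by case: Dm => ->; [left|right]; rewrite ?mulrN.
move: Dfh; rewrite Dg mulrCA => /(mulfI phi_neq0)/(IHs _ _ s_gt0)[m [sz_m Dm]].
by exists (false :: m); rewrite /= sz_m.
Qed.

(** * Polynomials with coefficients 0 and 1 *)

Lemma coef_sum_Xn (R : nzRingType) (I : finType) (e : I -> nat) (n : nat) :
  injective e -> (\sum_i 'X^(e i) : {poly R})`_n = [exists i, e i == n]%:R.
Proof.
move=> inj_e; rewrite coef_sum; under eq_bigr do rewrite coefXn eq_sym.
case: existsP => [[i /eqP Di]|no_i].
  rewrite (bigD1 i) //= Di eqxx big1 ?addr0 // => j /negbTE j'i.
  by rewrite -Di (inj_eq inj_e) j'i.
by rewrite big1 // => i _; case: eqP => // Di; case: no_i; exists i; apply/eqP.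
Qed.

Definition zero_one (f : {poly int}) := forall n, 0 <= f`_n <= 1.

Lemma zero_one_sum_Xn (I : finType) (e : I -> nat) :
  injective e -> zero_one (\sum_i 'X^(e i)).
Proof. by move=> inj_e n; rewrite (coef_sum_Xn _ _ inj_e); case: existsP. Qed.

Lemma coefXn_sub1M (R : nzRingType) (f : {poly R}) (k n : nat) :
  (('X^k - 1) * f)`_n = (if (n < k)%N then 0 else f`_(n - k)) - f`_n.
Proof. by rewrite mulrBl mul1r coefB coefXnM. Qed.

Lemma zero_one_flat (f : {poly int}) : zero_one f -> forall n, `|f`_n| <= 1.
Proof. by move=> f01 n; have := f01 n; lia. Qed.

(** Each coefficient is a difference of two numbers in [0, 1]. *)
Lemma zero_oneXn_sub1M_flat (f : {poly int}) (k : nat) :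
  zero_one f -> forall n, `|(('X^k - 1) * f)`_n| <= 1.
Proof.
move=> f01 n; rewrite coefXn_sub1M.
have := f01 n; have := f01 (n - k)%N; move: (f`_n) (f`_(n - k)) => a b.
by case: ifP => _; lia.
Qed.

Lemma zero_one1 : zero_one 1.
Proof. by move=> n; rewrite coef1; case: eqP. Qed.

(** * Cyclotomic identities at the divisors of [pq] *)

Lemma Cyclotomic1 : 'Phi_1 = 'X - 1 :> {poly int}.
Proof. by rewrite -['X]expr1 -prod_Cyclotomic // big_seq1. Qed.

Lemma Xn_sub1_prime r : prime r -> 'X^r - 1 = 'Phi_1 * 'Phi_r.
Proof.
move=> r_pr; have r_gt0 := prime_gt0 r_pr; rewrite -prod_Cyclotomic //.
rewrite (perm_big [:: 1%N; r]) ?[LHS]big_cons ?big_seq1 //.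
apply: uniq_perm; rewrite ?divisors_uniq //=.
  by rewrite inE eq_sym; case: eqP r_pr => // ->.
move=> d; rewrite -dvdn_divisors // !inE.
by apply/idP/pred2P => [/(primeP r_pr).2/pred2P//|[]->].
Qed.

Lemma Cyclotomic_prime r : prime r -> 'Phi_r = \sum_(i < r) 'X^i.
Proof.
move=> r_pr; apply: (mulfI (monic_neq0 (Cyclotomic_monic 1))).
by rewrite -Xn_sub1_prime // Cyclotomic1 subrX1.
Qed.

Lemma zero_one_Cyclotomic_prime r : prime r -> zero_one 'Phi_r.
Proof.
by move=> r_pr; rewrite Cyclotomic_prime //; apply/zero_one_sum_Xn/ord_inj.
Qed.

Lemma Xn_sub1_pq p q : prime p -> prime q -> p != q ->
  'X^(p * q) - 1 = \prod_(d <- [:: 1%N; p; q; (p * q)%N]) 'Phi_d.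
Proof.
move=> p_pr q_pr p'q; have [p_gt0 q_gt0] := (prime_gt0 p_pr, prime_gt0 q_pr).
have [p_gt1 q_gt1] := (prime_gt1 p_pr, prime_gt1 q_pr).
rewrite -prod_Cyclotomic ?muln_gt0 ?p_gt0 //; apply: perm_big.
apply: uniq_perm; rewrite ?divisors_uniq //=; first by rewrite !inE; nia.
move=> d; rewrite -dvdn_divisors ?muln_gt0 ?p_gt0 // !inE.
apply/idP/or4P => [dv_d|[] /eqP->]; last 1 first.
- by [].
(* Either [p] divides [d] and the quotient divides [q], or [d] is coprime to [p] and itself divides
   [q]. *)
- have [p_d|p'd] := boolP (p %| d)%N.
    have /dvdnP[e De] := p_d; move: dv_d; rewrite De mulnC dvdn_pmul2l //.
    by move/(primeP q_pr).2 => /pred2P[] ->; rewrite ?muln1 eqxx; constructor.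
  have co_d : coprime d p by rewrite coprime_sym prime_coprime.
  move: dv_d; rewrite Gauss_dvdr // => /(primeP q_pr).2/pred2P[] ->.
    by constructor.
  by constructor.
- exact: dvd1n.
- exact: dvdn_mulr.
- exact: dvdn_mull.
Qed.

(** The right side is [Phi_q(X^p)]: multiplied by [X^p - 1 = Phi_1 Phi_p], both sides become
    [X^(pq) - 1]. *)
Lemma Cyclotomic_prime_mul_pq p q : prime p -> prime q -> p != q ->
  'Phi_q * 'Phi_(p * q) = \sum_(i < q) 'X^(p * i).
Proof.
move=> p_pr q_pr p'q.
have nz : 'X^p - 1 != 0 :> {poly int}.
  by rewrite monic_neq0 // monicXnsubC ?prime_gt0.
apply: (mulfI nz); rewrite {1}Xn_sub1_prime //.
under eq_bigr do rewrite exprM.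
rewrite -subrX1 -exprM Xn_sub1_pq // !big_cons big_nil mulr1.
by rewrite !mulrA.
Qed.

Lemma zero_one_Cyclotomic_prime_mul_pq p q : prime p -> prime q -> p != q ->
  zero_one ('Phi_q * 'Phi_(p * q)).
Proof.
move=> p_pr q_pr p'q; rewrite Cyclotomic_prime_mul_pq //.
apply: zero_one_sum_Xn => i j /eqP; rewrite eqn_pmul2l ?prime_gt0 // => /eqP.
exact: ord_inj.
Qed.

Lemma Cyclotomic_pq_cofactor p q : prime p -> prime q -> p != q ->
  'Phi_p * 'Phi_q * 'Phi_(p * q) = \sum_(i < p * q) 'X^i.
Proof.
move=> p_pr q_pr p'q; apply: (mulfI (monic_neq0 (Cyclotomic_monic 1))).
rewrite {2}Cyclotomic1 -subrX1 Xn_sub1_pq // !big_cons big_nil mulr1.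
by rewrite !mulrA.
Qed.

(** * Flatness of [Phi_pq] *)

(** Modulo [n] the equation says that [n] divides [m (i' - i)], hence [i' - i], which is smaller
    than [n]. *)
Lemma coprime_repr_inj m n (i i' : 'I_n) x x' : coprime m n ->
  (m * i + n * x = m * i' + n * x')%N -> i = i'.
Proof.
move=> co_mn; wlog le_i : i i' x x' / (i <= i')%N.
  move=> IH Deq; have [le_i|/ltnW le_i] := leqP i i'; first exact: (IH _ _ x x').
  by apply/esym/(IH _ _ x' x).
move=> Deq; have: (n %| m * (i' - i))%N.
  by apply/dvdnP; exists (x - x')%N; rewrite mulnBr mulnBl; lia.
rewrite Gauss_dvdr 1?coprime_sym // => dv_n; apply: ord_inj.
have [lt_i|] := ltnP i i'; last by lia.
have := dvdn_leq _ dv_n; rewrite subn_gt0 lt_i => /(_ isT).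
by have := ltn_ord i'; lia.
Qed.

Lemma zero_one_prod_sums p q : prime p -> prime q -> p != q ->
  zero_one ((\sum_(i < q) 'X^(p * i)) * (\sum_(j < p) 'X^(q * j))).
Proof.
move=> p_pr q_pr p'q.
have co_pq : coprime p q by rewrite prime_coprime // dvdn_prime2.
rewrite big_distrlr /= pair_big /=.
under eq_bigr do rewrite -exprD.
apply: zero_one_sum_Xn => -[i j] [i' j'] /= Deq.
rewrite (coprime_repr_inj co_pq Deq); congr (_, _).
move: Deq; rewrite addnC [RHS]addnC; apply: coprime_repr_inj.
by rewrite coprime_sym.
Qed.

Lemma Cyclotomic_pq_flat p q : prime p -> prime q -> p != q ->
  forall n, `|'Phi_(p * q)`_n| <= 1.
Proof.
move=> p_pr q_pr p'q n.
(* From index [pq] on the coefficient is 0, as the degree is [(p - 1)(q - 1)]. *)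
have [lt_n|le_n] := ltnP n (p * q); last first.
  rewrite nth_default // size_Cyclotomic; apply: leq_trans le_n.
  rewrite totient_coprime; last by rewrite prime_coprime // dvdn_prime2.
  rewrite !totient_prime //.
  by have := prime_gt1 p_pr; have := prime_gt1 q_pr; nia.
(* The two sums are [Phi_q Phi_pq] and [Phi_p Phi_pq], so the right side contains [Phi_pq] twice.
   Below index [pq] the left side has the coefficients of [- Phi_pq]. *)
have: ('X^(p * q) - 1) * 'Phi_(p * q) = ('X^1 - 1) *
  ((\sum_(i < q) 'X^(p * i)) * (\sum_(j < p) 'X^(q * j))).
  rewrite -!Cyclotomic_prime_mul_pq // 1?eq_sym // (mulnC q p) Xn_sub1_pq //.
  by rewrite !big_cons big_nil mulr1 expr1 -Cyclotomic1; ring.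
move/(congr1 (fun f : {poly int} => f`_n)); rewrite coefXn_sub1M lt_n sub0r.
move=> Dn; rewrite -normrN Dn; apply: zero_oneXn_sub1M_flat.
exact: zero_one_prod_sums.
Qed.

(** * The two exceptional products *)

Lemma coef0_Cyclotomic_pq p q : prime p -> prime q -> p != q ->
  'Phi_(p * q)`_0 = 1.
Proof.
move=> p_pr q_pr p'q.
have sum0 r : (0 < r)%N -> (\sum_(i < r) 'X^i : {poly int})`_0 = 1.
  move=> r_gt0; rewrite (coef_sum_Xn _ _ (@ord_inj r)).
  by case: existsP => // -[]; exists (Ordinal r_gt0).
have [p_gt0 q_gt0] := (prime_gt0 p_pr, prime_gt0 q_pr).
have := sum0 (p * q)%N; rewrite muln_gt0 p_gt0 => /(_ q_gt0).
rewrite -Cyclotomic_pq_cofactor // !coef0M (Cyclotomic_prime p_pr).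
rewrite (Cyclotomic_prime q_pr).
by rewrite !sum0 // !mul1r.
Qed.

(** Coefficients are differences of two values in [-1, 1]. The leading one is 1 and the constant one
    is -1, so only 2 and -2 remain undecided. *)
Lemma coefficient_convex_Phi1_pq p q : prime p -> prime q -> p != q ->
  coefficient_convex ('Phi_1 * 'Phi_(p * q)).
Proof.
move=> p_pr q_pr p'q; have flat := Cyclotomic_pq_flat p_pr q_pr p'q.
rewrite Cyclotomic1 -[X in X - 1]expr1.
apply: (coefficient_convex_near (m := 1)) => [n|c le_c].
  rewrite coefXn_sub1M; have := flat n; have := flat (n - 1)%N.
  move: (_`_(n - 1)) (_`_n) => a b; case: ifP => _; lia.
set g := _ * _; apply/coef_set0P.
have [->|[->|->]] : c = 0 \/ (c = 1 \/ c = -1) by lia.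
- by exists (size g); rewrite nth_default.
- exists (size g).-1; rewrite -lead_coefE; apply/eqP; rewrite -monicE.
  by rewrite monicMr ?Cyclotomic_monic ?monicXnsubC.
- by exists 0; rewrite coefXn_sub1M /= coef0_Cyclotomic_pq.
Qed.

(** Multiplying by [Phi_p] sums windows of [p] consecutive coefficients of [Phi_q], which bounds the
    result by 0 and [p]; the first [p] windows yield 1, ..., [p] in turn. *)
Lemma coefficient_convex_Phi_p_q p q : prime p -> prime q -> (p < q)%N ->
  coefficient_convex ('Phi_p * 'Phi_q).
Proof.
move=> p_pr q_pr lt_pq.
have q01 := zero_one_Cyclotomic_prime q_pr.
have Dcoef n : ('Phi_p * 'Phi_q)`_n =
    \sum_(i < p) (if (n < i)%N then 0 else 'Phi_q`_(n - i)).
  rewrite {1}Cyclotomic_prime // mulr_suml coef_sum.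
  by apply: eq_bigr => i _; rewrite coefXnM.
have Dlow n : (n < p)%N -> ('Phi_p * 'Phi_q)`_n = n.+1%:Z.
  move=> lt_np; rewrite Dcoef -natz -[n.+1 in RHS]card_ord -sumr_const.
  rewrite (big_ord_widen _ (fun=> 1) lt_np) [RHS]big_mkcond.
  apply: eq_bigr => i _; rewrite ltnS ltnNge; case: leqP => //= le_in.
  rewrite Cyclotomic_prime // (coef_sum_Xn _ _ (@ord_inj q)).
  (* Here [p < q] enters: for [n < p] the window stays below index [q], where every coefficient of
     [Phi_q] is 1. *)
  have lt_nq : (n - i < q)%N by lia.
  by case: existsP => // -[]; exists (Ordinal lt_nq).
exists 0, p%:Z; split=> // c; apply/coef_set0P/idP => [[n <-]|].
  rewrite Dcoef; apply/andP; split.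
    by apply: sumr_ge0 => i _; case: ifP => // _; case/andP: (q01 (n - i)%N).
  rewrite -[p%:Z]natz -[p in p%:R]card_ord -sumr_const; apply: ler_sum => i _.
  by case: ifP => // _; case/andP: (q01 (n - i)%N).
case: c => [[|k]|//] /= le_k.
  by exists (size ('Phi_p * 'Phi_q)); rewrite nth_default.
by exists k; rewrite Dlow.
Qed.

Theorem corollary1 (p q : nat) (hp : prime p) (hq : prime q) (hpq : (p < q)%N)
    (f : {poly int}) (hf : divides_in_Zx f ('X^(p * q) - 1)) :
  coefficient_convex f.
Proof.
have p'q : p != q by rewrite neq_ltn hpq.
have q'p : q != p by rewrite eq_sym.
case: hf => h; rewrite Xn_sub1_pq // => /divisor_prod_Cyclotomic[].
  by rewrite /= muln_gt0 !prime_gt0.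
move=> m [sz_m Df].
suffices {f h Df}: coefficient_convex
    (\prod_(d <- mask m [:: 1%N; p; q; (p * q)%N]) 'Phi_d).
  by case: Df => -> // /coefficient_convexN.
have q01 := zero_one_Cyclotomic_prime hq.
have p01 := zero_one_Cyclotomic_prime hp.
have qpq01 := zero_one_Cyclotomic_prime_mul_pq hp hq p'q.
have ppq01 := zero_one_Cyclotomic_prime_mul_pq hq hp q'p.
rewrite mulnC in ppq01.
have pqpq01 : zero_one ('Phi_p * ('Phi_q * 'Phi_(p * q))).
  by rewrite mulrA Cyclotomic_pq_cofactor //; apply/zero_one_sum_Xn/ord_inj.
have flat1 (g : {poly int}) : zero_one g -> coefficient_convex ('Phi_1 * g).
  move=> g01; rewrite Cyclotomic1 -['X]expr1.
  exact/coefficient_convex_flat/zero_oneXn_sub1M_flat.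
have flat0 (g : {poly int}) : zero_one g -> coefficient_convex g.
  by move=> g01; apply/coefficient_convex_flat/zero_one_flat.
case: m sz_m => [|a [|b [|c [|d []]]]] //= _.
(* The bits select [Phi_1], [Phi_p], [Phi_q], [Phi_pq] in this order, and the cases run from all
   four factors down to the empty product. *)
case: a b c d => [] [] [] []; rewrite /= ?big_cons big_nil ?mulr1.
- exact: flat1.
(* [Phi_p Phi_q] is not zero-one, so [Phi_1] is absorbed into [Phi_p], leaving [(X^p - 1) Phi_q]. *)
- rewrite mulrA -Xn_sub1_prime //.
  exact/coefficient_convex_flat/zero_oneXn_sub1M_flat.
- exact: flat1.
- exact: flat1.
- exact: flat1.
- exact: flat1.
- exact: coefficient_convex_Phi1_pq.
- by rewrite -['Phi_1]mulr1; exact/flat1/zero_one1.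
- exact: flat0.
- exact: coefficient_convex_Phi_p_q.
- exact: flat0.
- exact: flat0.
- exact: flat0.
- exact: flat0.
- exact/coefficient_convex_flat/Cyclotomic_pq_flat.
- exact/flat0/zero_one1.
Qed.
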